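(* (Type $q$-P$(A_1^{(1)})$ with $|\alpha^2|=8$.) Let $$L_1=\frac{g\nu_1\nu_2\nu_3\nu_4}{f}+\frac{\nu_1z}{q}+\frac{\nu_1\nu_2\nu_3(\frac zq-\nu_4)}{f-\frac zq}(g-T_z^{-1})-\frac{\frac{\kappa_1}{\nu_8}z}{q(f-z)}\Bigl(T_z-\frac1g\Bigr).$$ Set $f=\nu_4$. Then the equation $L_1y(z)=0$ is written as $$\frac{\kappa_1}{\nu_8}z\,y(qz)+(\nu_1z^2-dz)y(z)+q\nu_1\nu_2\nu_3(z-\nu_4)y(z/q)=0,$$ $$d=\frac{\nu_1\nu_4}{q}+\frac{\kappa_1}{q\nu_8}\frac1g .$$ By a gauge transformation, we obtain $$\frac{\kappa_1}{\nu_8}z(qz-\nu_4)y(qz)+(\nu_1z^2-dz)y(z)+q\nu_1\nu_2\nu_3\,y(z/q)=0.$$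
   Context: The parameters $\kappa_1,\kappa_2,\nu_1,\dots,\nu_8$ satisfy $\kappa_1^2\kappa_2^2=q\nu_1\nu_2\cdots\nu_8$. $T_z$ is the $q$-shift operator on the variable $z$: $T_zy(z)=y(qz)$, $T_z^{-1}y(z)=y(z/q)$. $L_1$ is an operator of the Kajiwara–Noumi–Yamada Lax pair for the $q$-Painlevé equation of type $A_1^{(1)}$ with $|\alpha^2|=8$ (labelled by its symmetry), whose dependent variables $f,g$ are here treated as parameters. A gauge transformation means multiplying the unknown function by a suitable function; the new unknown function is again denoted by $y$.
   Formalization: The printed d has a spurious 1/q and is corrected to d = ν1ν4 + κ1/(ν8 g); the gauge step assumes q is not a root of unity (no gauge factor exists otherwise in general) and z outside 0, ν4 q^Z and −q^Z, where the factor degenerates. *)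

(* Defs.v *)
From Stdlib Require Import Reals.
From Coquelicot Require Import Coquelicot.
Open Scope C_scope.

Definition Tz (q : C) (y : C -> C) (z : C) : C := y (q * z).
Definition Tz_inv (q : C) (y : C -> C) (z : C) : C := y (z / q).

(* The Lax operator, for arbitrary parameters f and g; the parameters
   kappa2, nu5, nu6, nu7 do not occur in it.  Since [x / 0] is a junk value,
   it is only meaningful when q, nu8, f, g, f - z/q and f - z are nonzero. *)
Definition L1 (q kappa1 nu1 nu2 nu3 nu4 nu8 f g : C) (y : C -> C) (z : C) : C :=
  g * nu1 * nu2 * nu3 * nu4 / f * y z
  + nu1 * z / q * y z
  + nu1 * nu2 * nu3 * (z / q - nu4) / (f - z / q) * (g * y z - Tz_inv q y z)
  - kappa1 / nu8 * z / (q * (f - z)) * (Tz q y z - 1 / g * y z).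

(* The value is forced by clearing denominators: q (z - nu4) L1 at f = nu4
   has the coefficient nu1 z^2 - (nu1 nu4 + kappa1 / (nu8 g)) z at y(z).
   The printed value nu1 nu4 / q + kappa1 / (q nu8 g) has a spurious 1/q. *)
Definition d_coef (kappa1 nu1 nu4 nu8 g : C) : C :=
  nu1 * nu4 + kappa1 / nu8 * (1 / g).

Definition eq_specialized (q kappa1 nu1 nu2 nu3 nu4 nu8 d : C)
    (y : C -> C) (z : C) : Prop :=
  kappa1 / nu8 * z * y (q * z) + (nu1 * z ^ 2 - d * z) * y z
  + q * nu1 * nu2 * nu3 * (z - nu4) * y (z / q) = 0.

Definition eq_gauged (q kappa1 nu1 nu2 nu3 nu4 nu8 d : C)
    (y : C -> C) (z : C) : Prop :=
  kappa1 / nu8 * z * (q * z - nu4) * y (q * z) + (nu1 * z ^ 2 - d * z) * y z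
  + q * nu1 * nu2 * nu3 * y (z / q) = 0.

(* z lies in a * q^Z (for q <> 0). *)
Definition q_spiral (q a z : C) : Prop :=
  exists n : nat, z = a * q ^ n \/ z * q ^ n = a.

(* A domain stable under z |-> q z and z |-> z / q.  The gauge factor has to
   satisfy (q z - nu4) phi(q z) = phi(z), so it degenerates at 0 and on
   nu4 q^Z; a single-valued meromorphic solution, such as
     (-q z; q)_oo (-1/z; q)_oo / (nu4/z; q)_oo       (|q| < 1),
   needs in addition a theta factor, whose zeros form the spiral -q^Z. *)
Definition gauge_domain (q nu4 z : C) : Prop :=
  z <> 0 /\ ~ q_spiral q nu4 z /\ ~ q_spiral q (- (1)) z.

(* Complex differentiability: C is taken as a normed module over itself. *)
Definition C_differentiable_at (f : C -> C) (z : C) : Prop :=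
  @ex_derive C_AbsRing (AbsRing_NormedModule C_AbsRing) f z.

(* Main.v *)
Require Import Defs.
From Stdlib Require Import Reals Lra Lia.
From Stdlib Require Import ClassicalEpsilon FunctionalExtensionality PropExtensionality.
From Coquelicot Require Import Coquelicot.
Open Scope C_scope.

(** Multiplying [L1 y = 0] by [q (z - nu4)] gives the specialized equation, and
    the gauge transformation is multiplication by a nowhere zero [phi] with
    [phi(z) = (q z - nu4) phi(q z)].

    With Euler's series for [(x; q)_oo], which satisfies
    [(x; q)_oo = (1 - x) (q x; q)_oo], such a [phi] is
    [(-q z; q)_oo (-1/z; q)_oo / (nu4/z; q)_oo] when [|q| < 1], and, with
    [p = 1/q], [(p nu4/z; p)_oo / ((-z; p)_oo (-p/z; p)_oo)] when [|q| > 1].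
    When [|q| = 1] and [q] is not a root of unity, the orbits of [z |-> q z] on
    nonzero [z] are free, so [phi] is normalized to 1 at a chosen
    representative of each orbit and extended by the functional equation. *)

(** * Complex differentiability from quadratic remainder bounds *)

(** Reduces differentiability to an explicit estimate, the form in which it is obtained both for
    [Cinv] and for power series. *)
Lemma C_differentiable_at_of_quadratic (f : C -> C) (w l : C) (K r : R) :
  (0 < r)%R ->
  (forall z : C, (Cmod (z - w) < r)%R ->
     (Cmod (f z - f w - (z - w) * l) <= K * Cmod (z - w) ^ 2)%R) ->
  C_differentiable_at f w.
Proof.
  intros Hr H. exists l. split.
  - apply is_linear_scal_l.
  - intros x Hx.
    (* The filter definition of the derivative speaks of every limit [x] of the neighbourhoods of
       [w]; uniqueness of limits leaves only [w]. *)
    assert (Ex : w = x) by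
      exact (@is_filter_lim_locally_unique C_AbsRing (AbsRing_NormedModule C_AbsRing) w x Hx).
    subst x. intros eps.
    (* [K] may have any sign; dividing by [Rabs K + 1] keeps the radius positive and still gives
       [K * Cmod (z - w) <= eps]. *)
    assert (Hd : (0 < Rmin r (eps / (Rabs K + 1)))%R).
    { apply Rmin_pos; [exact Hr|].
      apply Rdiv_lt_0_compat; [apply cond_pos|].
      pose proof (Rabs_pos K). lra. }
    exists (mkposreal _ Hd). intros z Hz.
    change (Cmod (z - w) < Rmin r (eps / (Rabs K + 1)))%R in Hz.
    change (Cmod (f z - f w - (z - w) * l) <= eps * Cmod (z - w))%R.
    assert (Hz1 : (Cmod (z - w) < r)%R) by
      (eapply Rlt_le_trans; [exact Hz|apply Rmin_l]).
    assert (Hz2 : (Cmod (z - w) < eps / (Rabs K + 1))%R) by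
      (eapply Rlt_le_trans; [exact Hz|apply Rmin_r]).
    eapply Rle_trans; [exact (H z Hz1)|].
    pose proof (Cmod_ge_0 (z - w)) as Hp.
    pose proof (Rabs_pos K) as HK. pose proof (Rle_abs K) as HK'.
    apply (Rmult_lt_compat_r (Rabs K + 1)) in Hz2; [|lra].
    unfold Rdiv in Hz2. rewrite Rmult_assoc, Rinv_l in Hz2 by lra.
    nra.
Qed.

Lemma C_differentiable_at_comp (f h : C -> C) (w : C) :
  C_differentiable_at f (h w) -> C_differentiable_at h w ->
  C_differentiable_at (fun z => f (h z)) w.
Proof. apply (@ex_derive_comp C_AbsRing). Qed.

Lemma C_differentiable_at_mult (f h : C -> C) (w : C) :
  C_differentiable_at f w -> C_differentiable_at h w ->
  C_differentiable_at (fun z => f z * h z) w.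
Proof.
  intros [a Ha] [b Hb]. eexists.
  exact (is_derive_mult (K := C_AbsRing) _ _ _ _ _ Ha Hb Cmult_comm).
Qed.

Lemma C_differentiable_at_id (w : C) : C_differentiable_at (fun z => z) w.
Proof. apply (@ex_derive_id C_AbsRing). Qed.

Lemma C_differentiable_at_const (c w : C) : C_differentiable_at (fun _ => c) w.
Proof. apply (@ex_derive_const C_AbsRing (AbsRing_NormedModule C_AbsRing)). Qed.

Lemma C_differentiable_at_Copp (f : C -> C) (w : C) :
  C_differentiable_at f w -> C_differentiable_at (fun z => - f z) w.
Proof. apply (@ex_derive_opp C_AbsRing (AbsRing_NormedModule C_AbsRing)). Qed.

(** The remainder is exactly [(z - w) ^ 2 / (z * w ^ 2)], and [Cmod z > Cmod w / 2] on the disc of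
    radius [Cmod w / 2]; hence the constant [2 / Cmod w ^ 3]. *)
Lemma C_differentiable_at_Cinv (w : C) : w <> 0 -> C_differentiable_at Cinv w.
Proof.
  intros Hw. pose proof (proj1 (Cmod_gt_0 w) Hw) as Hm.
  apply (C_differentiable_at_of_quadratic Cinv w (- / (w * w))
           (2 / Cmod w ^ 3) (Cmod w / 2)); [lra|].
  intros z Hz.
  assert (Hzw : (Cmod w / 2 < Cmod z)%R).
  { pose proof (Cmod_triangle z (- (z - w))) as T. rewrite Cmod_opp in T.
    replace (z + - (z - w)) with w in T by ring. lra. }
  assert (z <> 0) by (apply Cmod_gt_0; lra).
  replace (/ z - / w - (z - w) * - / (w * w)) with ((z - w) ^ 2 * / (z * w ^ 2))
    by (field; split; assumption).
  rewrite Cmod_mult, Cmod_inv, Cmod_mult, !Cmod_pow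
    by (apply Cmult_neq_0; [assumption|apply Cpow_nz; assumption]).
  rewrite Rmult_comm. apply Rmult_le_compat_r; [apply pow2_ge_0|].
  replace (2 / Cmod w ^ 3)%R with (/ ((Cmod w / 2) * Cmod w ^ 2))%R by (field; lra).
  apply Rinv_le_contravar; [apply Rmult_lt_0_compat; [lra|apply pow_lt; lra]|].
  apply Rmult_le_compat_r; [apply pow2_ge_0|lra].
Qed.

(** * Absolutely convergent complex series *)

Definition Csummable (a : nat -> C) : Prop := ex_series (fun n => Cmod (a n)).

Definition CSeries (a : nat -> C) : C :=
  (Series (fun n => Re (a n)), Series (fun n => Im (a n))).

Lemma Rabs_Im_le_Cmod (c : C) : (Rabs (Im c) <= Cmod c)%R.
Proof. eapply Rle_trans; [apply Rmax_r|apply Rmax_Cmod]. Qed.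

Lemma Csummable_le (a : nat -> C) (b : nat -> R) :
  (forall n, (Cmod (a n) <= b n)%R) -> ex_series b -> Csummable a.
Proof.
  intros H. apply (@ex_series_le R_AbsRing R_CompleteNormedModule).
  intros n. change (Rabs (Cmod (a n)) <= b n)%R.
  rewrite Rabs_pos_eq by apply Cmod_ge_0. apply H.
Qed.

Lemma ex_series_Re (a : nat -> C) : Csummable a -> ex_series (fun n => Re (a n)).
Proof.
  apply (@ex_series_le R_AbsRing R_CompleteNormedModule).
  intros n. apply re_le_Cmod.
Qed.

Lemma ex_series_Im (a : nat -> C) : Csummable a -> ex_series (fun n => Im (a n)).
Proof.
  apply (@ex_series_le R_AbsRing R_CompleteNormedModule).
  intros n. apply Rabs_Im_le_Cmod.
Qed.

Lemma Csummable_plus (a b : nat -> C) :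
  Csummable a -> Csummable b -> Csummable (fun n => a n + b n).
Proof.
  intros Ha Hb. eapply Csummable_le; [intros n; apply Cmod_triangle|].
  exact (ex_series_plus _ _ Ha Hb).
Qed.

Lemma Csummable_scal (c : C) (a : nat -> C) :
  Csummable a -> Csummable (fun n => c * a n).
Proof.
  intros Ha. eapply Csummable_le; [intros n; rewrite Cmod_mult; apply Rle_refl|].
  exact (ex_series_scal (Cmod c) _ Ha).
Qed.

Lemma CSeries_ext (a b : nat -> C) :
  (forall n, a n = b n) -> CSeries a = CSeries b.
Proof.
  intros H. unfold CSeries.
  f_equal; apply Series_ext; intros n; rewrite H; reflexivity.
Qed.

Lemma CSeries_plus (a b : nat -> C) :
  Csummable a -> Csummable b ->
  CSeries (fun n => a n + b n) = CSeries a + CSeries b.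
Proof.
  intros Ha Hb. unfold CSeries, Cplus; simpl. f_equal.
  - apply (Series_plus (fun n => Re (a n)) (fun n => Re (b n)));
      apply ex_series_Re; assumption.
  - apply (Series_plus (fun n => Im (a n)) (fun n => Im (b n)));
      apply ex_series_Im; assumption.
Qed.

Lemma CSeries_scal (c : C) (a : nat -> C) :
  Csummable a -> CSeries (fun n => c * a n) = c * CSeries a.
Proof.
  intros Ha. pose proof (ex_series_Re _ Ha) as HR. pose proof (ex_series_Im _ Ha) as HI.
  unfold CSeries, Cmult; simpl. f_equal.
  - rewrite <- !Series_scal_l.
    apply (Series_minus (fun n => fst c * Re (a n))%R (fun n => snd c * Im (a n))%R).
    + exact (ex_series_scal (fst c) _ HR).
    + exact (ex_series_scal (snd c) _ HI).
  - rewrite <- !Series_scal_l.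
    apply (Series_plus (fun n => fst c * Im (a n))%R (fun n => snd c * Re (a n))%R).
    + exact (ex_series_scal (fst c) _ HI).
    + exact (ex_series_scal (snd c) _ HR).
Qed.

Lemma CSeries_incr_1 (a : nat -> C) :
  Csummable a -> CSeries a = a 0%nat + CSeries (fun n => a (S n)).
Proof.
  intros Ha. unfold CSeries, Cplus; simpl. f_equal.
  - apply (Series_incr_1 (fun n => Re (a n))), ex_series_Re, Ha.
  - apply (Series_incr_1 (fun n => Im (a n))), ex_series_Im, Ha.
Qed.

(** The real and imaginary parts are each bounded by [Series b]; the factor 2 comes from adding the
    two bounds. *)
Lemma Cmod_CSeries_le (a : nat -> C) (b : nat -> R) :
  (forall n, (Cmod (a n) <= b n)%R) -> ex_series b ->
  (Cmod (CSeries a) <= 2 * Series b)%R.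
Proof.
  intros H Hb.
  assert (Hpart : forall u : nat -> R,
            (forall n, (Rabs (u n) <= Cmod (a n))%R) -> (Rabs (Series u) <= Series b)%R).
  { intros u Hu.
    assert (Hub : forall n, (0 <= Rabs (u n) <= b n)%R).
    { intros n. split; [apply Rabs_pos|]. eapply Rle_trans; [apply Hu|apply H]. }
    eapply Rle_trans; [apply Series_Rabs|apply Series_le; assumption].
    apply (@ex_series_le R_AbsRing R_CompleteNormedModule) with b; [|exact Hb].
    intros n. change (Rabs (Rabs (u n)) <= b n)%R. rewrite Rabs_Rabsolu. apply Hub. }
  replace (CSeries a)
    with (RtoC (Re (CSeries a)) + Ci * RtoC (Im (CSeries a)))
    by (apply injective_projections; simpl; ring).
  eapply Rle_trans; [apply Cmod_triangle|].
  rewrite Cmod_mult, Cmod_Ci, !Cmod_R.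
  pose proof (Hpart (fun n => Re (a n)) (fun n => re_le_Cmod _)).
  pose proof (Hpart (fun n => Im (a n)) (fun n => Rabs_Im_le_Cmod _)).
  simpl. lra.
Qed.

(** * Power series with infinite radius of convergence *)

Lemma INR_le_pow2 (n : nat) : (INR n <= 2 ^ n)%R.
Proof.
  induction n as [|n IH]; [simpl; lra|].
  rewrite S_INR. simpl.
  assert (1 <= 2 ^ n)%R by (apply pow_R1_Rle; lra). lra.
Qed.

(** Induction on [n]: the next remainder is [z] times the current one plus [n w^(n-1) (z - w)^2].
    The factor [2 ^ n] absorbs [n], and [R0 + 1 <= 2 * R0] closes the step. For [n = 0] the factor
    [INR 0] kills the default exponent [pred 0]. *)
Lemma Cpow_taylor_bound (R0 : R) (z w : C) (n : nat) :
  (1 <= R0)%R -> (Cmod z <= R0)%R -> (Cmod w <= R0)%R ->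
  (Cmod (z ^ n - w ^ n - (z - w) * (RtoC (INR n) * w ^ pred n))
    <= (2 * R0) ^ n * Cmod (z - w) ^ 2)%R.
Proof.
  intros HR Hz Hw. induction n as [|n IH].
  - replace (z ^ 0 - w ^ 0 - (z - w) * (RtoC (INR 0) * w ^ pred 0)) with (RtoC 0)
      by (simpl; ring).
    rewrite Cmod_0. apply Rmult_le_pos; [simpl; lra|apply pow2_ge_0].
  - replace (z ^ S n - w ^ S n - (z - w) * (RtoC (INR (S n)) * w ^ pred (S n)))
      with (z * (z ^ n - w ^ n - (z - w) * (RtoC (INR n) * w ^ pred n))
            + RtoC (INR n) * w ^ pred n * (z - w) ^ 2).
    2:{ rewrite S_INR, RtoC_plus. destruct n as [|n]; [simpl; ring|].
        simpl pred. rewrite !Cpow_S. ring. }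
    eapply Rle_trans; [apply Cmod_triangle|].
    rewrite !Cmod_mult, !Cmod_pow, Cmod_R, (Rabs_pos_eq _ (pos_INR n)).
    pose proof (Cmod_ge_0 z) as Hz0. pose proof (Cmod_ge_0 w) as Hw0.
    assert (Hwp : (Cmod w ^ pred n <= R0 ^ n)%R).
    { eapply Rle_trans; [apply pow_incr; split; [exact Hw0|exact Hw]|].
      apply Rle_pow; [lra|lia]. }
    assert (Hnp : (INR n * Cmod w ^ pred n <= (2 * R0) ^ n)%R).
    { rewrite Rpow_mult_distr.
      apply Rmult_le_compat; [apply pos_INR|apply pow_le; lra|apply INR_le_pow2|exact Hwp]. }
    pose proof (pow2_ge_0 (Cmod (z - w))) as Hh.
    assert (H0 : (0 <= (2 * R0) ^ n)%R) by (apply pow_le; lra).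
    assert (Cmod z * Cmod (z ^ n - w ^ n - (z - w) * (RtoC (INR n) * w ^ pred n))
            <= R0 * ((2 * R0) ^ n * Cmod (z - w) ^ 2))%R
      by (apply Rmult_le_compat; [exact Hz0|apply Cmod_ge_0|exact Hz|exact IH]).
    pose proof (Rmult_le_compat_r _ _ _ Hh Hnp).
    assert (0 <= (R0 - 1) * ((2 * R0) ^ n * Cmod (z - w) ^ 2))%R
      by (apply Rmult_le_pos; [lra|apply Rmult_le_pos; assumption]).
    change ((2 * R0) ^ S n)%R with (2 * R0 * (2 * R0) ^ n)%R. lra.
Qed.

Definition entire_coef (a : nat -> C) : Prop :=
  forall r : R, ex_series (fun n => Cmod (a n) * r ^ n)%R.

Definition Cpseries (a : nat -> C) (z : C) : C := CSeries (fun n => a n * z ^ n).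

Lemma Csummable_pseries (a : nat -> C) (z : C) :
  entire_coef a -> Csummable (fun n => a n * z ^ n).
Proof.
  intros Ha. eapply Csummable_le; [|exact (Ha (Cmod z))].
  intros n. rewrite Cmod_mult, Cmod_pow. apply Rle_refl.
Qed.

(** Sums the monomial bounds: [l] is the termwise derivative at [w], and [K] is finite because the
    series converges absolutely at radius [2 * R0]. The bound holds on a whole disc, so it also
    serves to estimate values near 0. *)
Lemma Cpseries_taylor_bound (a : nat -> C) (R0 : R) (w : C) :
  entire_coef a -> (1 <= R0)%R -> (Cmod w <= R0)%R ->
  exists (l : C) (K : R), forall z : C, (Cmod z <= R0)%R ->
    (Cmod (Cpseries a z - Cpseries a w - (z - w) * l) <= K * Cmod (z - w) ^ 2)%R.
Proof.
  intros Ha HR Hw.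
  set (b := fun n => a n * (RtoC (INR n) * w ^ pred n)).
  assert (Hb : Csummable b).
  { eapply Csummable_le; [|exact (Ha (2 * R0)%R)].
    intros n. unfold b. rewrite !Cmod_mult, Cmod_R, Cmod_pow, (Rabs_pos_eq _ (pos_INR n)).
    apply Rmult_le_compat_l; [apply Cmod_ge_0|]. rewrite Rpow_mult_distr.
    apply Rmult_le_compat;
      [apply pos_INR|apply pow_le, Cmod_ge_0|apply INR_le_pow2|].
    eapply Rle_trans; [apply pow_incr; split; [apply Cmod_ge_0|exact Hw]|].
    apply Rle_pow; [lra|lia]. }
  exists (CSeries b), (2 * Series (fun n => Cmod (a n) * (2 * R0) ^ n))%R.
  intros z Hz.
  (* Gathering the remainder into one series makes a termwise estimate possible. *)
  assert (E : Cpseries a z - Cpseries a w - (z - w) * CSeries b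
              = CSeries (fun n => (a n * z ^ n + (- (1)) * (a n * w ^ n))
                                  + (- (z - w)) * b n)).
  { pose proof (Csummable_pseries a z Ha). pose proof (Csummable_pseries a w Ha).
    rewrite CSeries_plus, CSeries_plus, !CSeries_scal;
      repeat (apply Csummable_plus || apply Csummable_scal); try assumption.
    unfold Cpseries. ring. }
  rewrite E, Rmult_assoc, <- Series_scal_r.
  apply Cmod_CSeries_le; [|exact (ex_series_scal_r _ _ (Ha (2 * R0)%R))].
  intros n. unfold b.
  replace (a n * z ^ n + - (1) * (a n * w ^ n)
           + - (z - w) * (a n * (RtoC (INR n) * w ^ pred n)))
    with (a n * (z ^ n - w ^ n - (z - w) * (RtoC (INR n) * w ^ pred n))) by ring.
  rewrite Cmod_mult, Rmult_assoc.
  apply Rmult_le_compat_l; [apply Cmod_ge_0|].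
  apply Cpow_taylor_bound; assumption.
Qed.

Lemma C_differentiable_at_Cpseries (a : nat -> C) (w : C) :
  entire_coef a -> C_differentiable_at (Cpseries a) w.
Proof.
  intros Ha. pose proof (Cmod_ge_0 w).
  destruct (Cpseries_taylor_bound a (Cmod w + 1) w Ha) as (l & K & H1); [lra|lra|].
  apply (C_differentiable_at_of_quadratic _ w l K 1); [lra|].
  intros z Hz. apply H1.
  replace z with (w + (z - w)) by ring.
  eapply Rle_trans; [apply Cmod_triangle|lra].
Qed.

Lemma Cpseries_0 (a : nat -> C) : entire_coef a -> Cpseries a 0 = a 0%nat.
Proof.
  intros Ha. pose proof (Csummable_pseries a 0 Ha) as H.
  unfold Cpseries. rewrite (CSeries_incr_1 _ H).
  rewrite (CSeries_ext _ (fun n => 0 * (a n * 0 ^ n))).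
  - rewrite (CSeries_scal 0 _ H). simpl. ring.
  - intros n. simpl. ring.
Qed.

(** * Euler's series for the infinite q-Pochhammer product *)

(** In closed form [(-1)^n q^(n(n-1)/2) / (q; q)_n]. The recursion compares coefficients in
    [F(x) = (1 - x) F(q x)]. *)
Fixpoint qexp_coef (q : C) (n : nat) : C :=
  match n with
  | 0%nat => 1
  | S m => - (qexp_coef q m * q ^ m / (1 - q ^ S m))
  end.

(* Euler's expansion of the infinite product (x; q)_oo. *)
Definition qpoch (q : C) : C -> C := Cpseries (qexp_coef q).

Section QPochhammer.

Context (q : C) (Hq0 : q <> 0) (Hq1 : (Cmod q < 1)%R).

(** A bound uniform in [n], as the ratio test requires; it holds because
    [Cmod (q ^ S n) <= Cmod q]. *)
Lemma one_minus_Cpow_lower_bound (n : nat) : (1 - Cmod q <= Cmod (1 - q ^ S n))%R.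
Proof.
  pose proof (Cmod_triangle (1 - q ^ S n) (q ^ S n)) as T.
  replace (1 - q ^ S n + q ^ S n) with (RtoC 1) in T by ring.
  rewrite Cmod_1, Cmod_pow in T. simpl in T.
  pose proof (Cmod_ge_0 q).
  assert (Cmod q ^ n <= 1)%R.
  { rewrite <- (pow1 n). apply pow_incr. lra. }
  change (1 - q * q ^ n) with (1 - q ^ S n) in T. nra.
Qed.

Lemma one_minus_Cpow_neq_0 (n : nat) : 1 - q ^ S n <> 0.
Proof. apply Cmod_gt_0. pose proof (one_minus_Cpow_lower_bound n). lra. Qed.

Lemma Cmod_qexp_coef_S (n : nat) :
  Cmod (qexp_coef q (S n))
  = (Cmod (qexp_coef q n) * (Cmod q ^ n / Cmod (1 - q ^ S n)))%R.
Proof.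
  simpl qexp_coef. change (q * q ^ n) with (q ^ S n).
  rewrite Cmod_opp, Cmod_div by apply one_minus_Cpow_neq_0.
  rewrite Cmod_mult, Cmod_pow. unfold Rdiv. ring.
Qed.

Lemma Cmod_qexp_coef_pos (n : nat) : (0 < Cmod (qexp_coef q n))%R.
Proof.
  pose proof (proj1 (Cmod_gt_0 q) Hq0).
  induction n as [|n IH]; [simpl; rewrite Cmod_1; lra|].
  rewrite Cmod_qexp_coef_S. apply Rmult_lt_0_compat; [exact IH|].
  apply Rdiv_lt_0_compat; [apply pow_lt; assumption|].
  apply Cmod_gt_0, one_minus_Cpow_neq_0.
Qed.

(** Ratio test: consecutive terms have ratio [r |q|^n / |1 - q^(n+1)|], at most
    [r / (1 - |q|) * |q|^n], which tends to 0. *)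
Lemma entire_qexp_coef : entire_coef (qexp_coef q).
Proof.
  assert (Hpos : forall r : R, (0 < r)%R ->
            ex_series (fun n => Cmod (qexp_coef q n) * r ^ n)%R).
  { intros r Hr. set (u := fun n => (Cmod (qexp_coef q n) * r ^ n)%R).
    assert (Hu : forall n, (0 < u n)%R)
      by (intros n; apply Rmult_lt_0_compat; [apply Cmod_qexp_coef_pos|apply pow_lt, Hr]).
    apply (ex_series_ext (fun n => Rabs (u n)));
      [intros n; apply Rabs_pos_eq, Rlt_le, Hu|].
    apply (ex_series_DAlembert u 0); [lra|intros n; apply Rgt_not_eq, Hu|].
    apply (is_lim_seq_le_le (fun _ => 0%R) _ (fun n => r / (1 - Cmod q) * Cmod q ^ n)%R).
    - intros n. split; [apply Rabs_pos|].
      replace (u (S n) / u n)%R with (r * Cmod q ^ n * / Cmod (1 - q ^ S n))%R.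
      2:{ unfold u. rewrite Cmod_qexp_coef_S. simpl (r ^ S n)%R. field.
          repeat split; apply Rgt_not_eq;
            first [exact Hr | apply pow_lt, Hr | apply Cmod_qexp_coef_pos
                  | apply Cmod_gt_0, one_minus_Cpow_neq_0]. }
      pose proof (one_minus_Cpow_lower_bound n).
      assert (0 <= r * Cmod q ^ n)%R
        by (apply Rmult_le_pos; [lra|apply pow_le, Cmod_ge_0]).
      rewrite Rabs_pos_eq.
      + replace (r / (1 - Cmod q) * Cmod q ^ n)%R
          with (r * Cmod q ^ n * / (1 - Cmod q))%R by (field; lra).
        apply Rmult_le_compat_l; [assumption|]. apply Rinv_le_contravar; lra.
      + apply Rmult_le_pos; [assumption|]. apply Rlt_le, Rinv_0_lt_compat. lra.
    - apply is_lim_seq_const.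
    - replace (Finite 0) with (Rbar_mult (r / (1 - Cmod q))%R 0)
        by (simpl; f_equal; ring).
      apply is_lim_seq_scal_l, is_lim_seq_geom.
      rewrite Rabs_pos_eq; [exact Hq1|apply Cmod_ge_0]. }
  (* The ratio test divides by the terms and so was run for positive radii; any real [r] is
     dominated by the positive radius [Rabs r + 1]. *)
  intros r. assert (Hr : (0 < Rabs r + 1)%R) by (pose proof (Rabs_pos r); lra).
  apply (@ex_series_le R_AbsRing R_CompleteNormedModule) with (2 := Hpos _ Hr).
  intros n. change (Rabs (Cmod (qexp_coef q n) * r ^ n)
                    <= Cmod (qexp_coef q n) * (Rabs r + 1) ^ n)%R.
  rewrite Rabs_mult, (Rabs_pos_eq _ (Cmod_ge_0 _)), <- RPow_abs.
  apply Rmult_le_compat_l; [apply Cmod_ge_0|].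
  apply pow_incr. pose proof (Rabs_pos r). lra.
Qed.

(** In the difference of the series at [x] and [q x] the constant terms cancel; after an index
    shift, the coefficient recursion turns the rest into [- x] times the series at [q x]. *)
Lemma qpoch_rec (x : C) : qpoch q x = (1 - x) * qpoch q (q * x).
Proof.
  assert (Hs : forall z, Csummable (fun n => qexp_coef q n * z ^ n))
    by (intros z; apply Csummable_pseries, entire_qexp_coef).
  assert (E : qpoch q x + - (1) * qpoch q (q * x) = - x * qpoch q (q * x)).
  { unfold qpoch at 1 2, Cpseries.
    rewrite <- (CSeries_scal (- (1))), <- CSeries_plus
      by (try apply Csummable_scal; apply Hs).
    rewrite CSeries_incr_1 by (apply Csummable_plus; try apply Csummable_scal; apply Hs).
    rewrite (CSeries_ext _ (fun n => - x * (qexp_coef q n * (q * x) ^ n))).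
    - rewrite CSeries_scal by apply Hs. simpl. unfold qpoch, Cpseries. ring.
    - intros n. pose proof (one_minus_Cpow_neq_0 n) as H.
      rewrite !Cpow_mult_l. simpl qexp_coef. simpl in H |- *. field. exact H. }
  replace ((1 - x) * qpoch q (q * x))
    with (qpoch q (q * x) + - x * qpoch q (q * x)) by ring.
  rewrite <- E. ring.
Qed.

Lemma qpoch_0 : qpoch q 0 = 1.
Proof. apply Cpseries_0, entire_qexp_coef. Qed.

Lemma C_differentiable_at_qpoch (x : C) : C_differentiable_at (qpoch q) x.
Proof. apply C_differentiable_at_Cpseries, entire_qexp_coef. Qed.

(* A zero off the spiral q^(-n) would propagate to all q^n x, hence to
   their limit 0, where the value is 1. *)
Lemma qpoch_neq_0 (x : C) : (forall n, q ^ n * x <> 1) -> qpoch q x <> 0.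
Proof.
  intros Hx H0.
  assert (Hn : forall n, qpoch q (q ^ n * x) = 0).
  { induction n as [|n IH]; [simpl; rewrite Cmult_1_l; exact H0|].
    rewrite qpoch_rec in IH. rewrite Cpow_S, <- Cmult_assoc.
    destruct (classic (qpoch q (q * (q ^ n * x)) = 0)) as [E|E]; [exact E|].
    exfalso. revert IH. apply Cmult_neq_0; [|exact E].
    intros E1. apply (Hx n). symmetry. apply Ceq_minus, E1. }
  destruct (Cpseries_taylor_bound (qexp_coef q) (Cmod x + 1) 0 entire_qexp_coef)
    as (l & K & HK).
  { pose proof (Cmod_ge_0 x). lra. }
  { rewrite Cmod_0. pose proof (Cmod_ge_0 x). lra. }
  fold (qpoch q) in HK. rewrite qpoch_0 in HK.
  (* With [t = Cmod (q ^ N * x) <= Cmod x], the Taylor bound at 0 gives [1 <= t |l| + K t^2]. This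
     sequence dominates the right-hand side and tends to 0, so some [N] makes it less than 1. *)
  assert (Hlim : is_lim_seq (fun n => (Cmod x * (Cmod l + Rabs K * Cmod x)) * Cmod q ^ n)%R 0).
  { replace (Finite 0) with (Rbar_mult (Cmod x * (Cmod l + Rabs K * Cmod x))%R 0)
      by (simpl; f_equal; ring).
    apply is_lim_seq_scal_l, is_lim_seq_geom.
    rewrite Rabs_pos_eq; [exact Hq1|apply Cmod_ge_0]. }
  apply is_lim_seq_spec in Hlim.
  destruct (Hlim (mkposreal 1 Rlt_0_1)) as [N HN].
  specialize (HN N (Nat.le_refl N)). simpl in HN. rewrite Rminus_0_r in HN.
  apply Rabs_def2 in HN. destruct HN as [HN _].
  pose proof (Cmod_ge_0 x) as Hx0. pose proof (Cmod_ge_0 l) as Hl0.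
  pose proof (Cmod_ge_0 q) as Hqp. pose proof (Rle_abs K). pose proof (Rabs_pos K).
  assert (Hq1n : (Cmod q ^ N <= 1)%R) by (rewrite <- (pow1 N); apply pow_incr; lra).
  assert (Hq0n : (0 <= Cmod q ^ N)%R) by (apply pow_le; lra).
  assert (Hm : Cmod (q ^ N * x) = (Cmod q ^ N * Cmod x)%R)
    by (rewrite Cmod_mult, Cmod_pow; reflexivity).
  assert (Hmx : (Cmod q ^ N * Cmod x <= Cmod x)%R) by nra.
  assert (Hm0 : (0 <= Cmod q ^ N * Cmod x)%R) by nra.
  specialize (HK (q ^ N * x)). rewrite Hn in HK.
  replace (q ^ N * x - 0) with (q ^ N * x) in HK by ring.
  rewrite Hm in HK. specialize (HK ltac:(lra)).
  pose proof (Cmod_triangle (0 - 1 - q ^ N * x * l) (q ^ N * x * l)) as T.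
  replace (0 - 1 - q ^ N * x * l + q ^ N * x * l) with (- (1)) in T by ring.
  rewrite Cmod_m1, (Cmod_mult (q ^ N * x)), Hm in T.
  set (t := (Cmod q ^ N * Cmod x)%R) in *.
  assert (K * t ^ 2 <= Rabs K * Cmod x * t)%R.
  { assert (K * t ^ 2 <= Rabs K * t ^ 2)%R
        by (apply Rmult_le_compat_r; [apply pow2_ge_0|assumption]).
    assert (0 <= Rabs K * (t * (Cmod x - t)))%R
      by (apply Rmult_le_pos; [assumption|apply Rmult_le_pos; lra]). nra. }
  replace (Cmod x * (Cmod l + Rabs K * Cmod x) * Cmod q ^ N)%R
    with (t * Cmod l + Rabs K * Cmod x * t)%R in HN by (unfold t; ring).
  lra.
Qed.

End QPochhammer.

(** * Gauge factors and stability of their domain *)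

(* A multiplier phi with phi(z) = (q z - nu) phi(q z) absorbs the factor
   z - nu of y(z/q) and creates the factor q z - nu of y(q z). *)
Definition gauge_factor (q nu : C) (phi : C -> C) : Prop :=
  forall z : C, gauge_domain q nu z ->
    phi z <> 0 /\ phi z = (q * z - nu) * phi (q * z).

Lemma not_q_spiral (q a z : C) :
  ~ q_spiral q a z -> forall n, z <> a * q ^ n /\ z * q ^ n <> a.
Proof. intros H n. split; intros E; apply H; exists n; tauto. Qed.

Lemma q_spiral_div (q a z : C) : q <> 0 -> q_spiral q a (z / q) -> q_spiral q a z.
Proof.
  intros Hq [n [E|E]].
  - exists (S n). left. rewrite Cpow_S.
    replace z with (z / q * q) by (field; exact Hq). rewrite E. ring.
  (* Exponent 0 means [z = a * q], which belongs to the other alternative; otherwise the exponent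
     drops by one. *)
  - destruct n as [|n].
    + exists 1%nat. left. rewrite <- E. simpl. field. exact Hq.
    + exists n. right. rewrite <- E, Cpow_S. field. exact Hq.
Qed.

(** Allows the functional equation of the gauge factor to be used at [z / q] as well as at [z]. *)
Lemma gauge_domain_div (q nu z : C) :
  q <> 0 -> gauge_domain q nu z -> gauge_domain q nu (z / q).
Proof.
  intros Hq (H0 & H1 & H2). repeat split.
  - apply Cmult_neq_0; [exact H0|]. intros E. apply C1_nz.
    rewrite <- (Cinv_r q Hq), E. ring.
  - intros H. apply H1, (q_spiral_div q); assumption.
  - intros H. apply H2, (q_spiral_div q); assumption.
Qed.

(** * The gauge factor for [|q| < 1] *)

Section SmallBase.

Context (q nu : C) (Hq0 : q <> 0) (Hq1 : (Cmod q < 1)%R).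

Definition gauge_lt1 (z : C) : C :=
  qpoch q (- (q * z)) * qpoch q (- / z) * / qpoch q (nu * / z).

(** A zero of the first two factors would put [z] on the spiral of -1, a zero of the third on the
    spiral of [nu]. *)
Lemma qpoch_gauge_lt1_neq_0 (z : C) : gauge_domain q nu z ->
  qpoch q (- (q * z)) <> 0 /\ qpoch q (- / z) <> 0 /\ qpoch q (nu * / z) <> 0.
Proof.
  intros (H0 & H1 & H2).
  repeat split; apply qpoch_neq_0; try assumption; intros n E.
  - apply (proj2 (not_q_spiral _ _ _ H2 (S n))). rewrite <- E, Cpow_S. ring.
  - apply (proj1 (not_q_spiral _ _ _ H2 n)).
    transitivity (z * (q ^ n * - / z)); [rewrite E; ring|field; exact H0].
  - apply (proj1 (not_q_spiral _ _ _ H1 n)).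
    transitivity (z * (q ^ n * (nu * / z))); [rewrite E; ring|field; exact H0].
Qed.

(** The numerator is a theta function with [theta(z) = q z theta(q z)]; the denominator contributes
    [1 - nu / (q z)]. Their product is [q z - nu]. *)
Lemma gauge_factor_lt1 : gauge_factor q nu gauge_lt1.
Proof.
  intros z Hz. pose proof (qpoch_gauge_lt1_neq_0 z Hz) as (HA & HB & HD).
  destruct Hz as (H0 & H1 & H2). split.
  - repeat apply Cmult_neq_0; try assumption.
    intros E. apply C1_nz. rewrite <- (Cinv_r _ HD), E. ring.
  - unfold gauge_lt1.
    assert (Hqz : q * z - nu <> 0).
    { intros E. apply (proj2 (not_q_spiral _ _ _ H1 1)).
      rewrite Cpow_1_r, Cmult_comm. apply Ceq_minus, E. }
    rewrite (qpoch_rec q Hq0 Hq1 (- (q * z))).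
    rewrite (qpoch_rec q Hq0 Hq1 (- / (q * z))), (qpoch_rec q Hq0 Hq1 (nu * / (q * z))).
    replace (q * - (q * z)) with (- (q * (q * z))) by ring.
    replace (q * - / (q * z)) with (- / z) by (field; split; assumption).
    replace (q * (nu * / (q * z))) with (nu * / z) by (field; split; assumption).
    replace (1 - nu * / (q * z)) with ((q * z - nu) * / (q * z))
      by (field; split; assumption).
    field. repeat split; assumption.
Qed.

Lemma C_differentiable_at_gauge_lt1 (z : C) :
  gauge_domain q nu z -> C_differentiable_at gauge_lt1 z.
Proof.
  intros Hz. pose proof (qpoch_gauge_lt1_neq_0 z Hz) as (_ & _ & HD).
  pose proof (C_differentiable_at_Cinv z (proj1 Hz)) as Hi.
  apply (C_differentiable_at_mult
           (fun z => qpoch q (- (q * z)) * qpoch q (- / z))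
           (fun z => / qpoch q (nu * / z)));
    [apply (C_differentiable_at_mult (fun z => qpoch q (- (q * z)))
              (fun z => qpoch q (- / z)))|].
  - apply (C_differentiable_at_comp (qpoch q) (fun z => - (q * z)));
      [apply C_differentiable_at_qpoch; assumption|].
    apply C_differentiable_at_Copp, (C_differentiable_at_mult (fun _ => q) (fun z => z)).
    + apply C_differentiable_at_const.
    + apply C_differentiable_at_id.
  - apply (C_differentiable_at_comp (qpoch q) (fun z => - / z));
      [apply C_differentiable_at_qpoch; assumption|].
    apply C_differentiable_at_Copp, Hi.
  - apply (C_differentiable_at_comp Cinv (fun z => qpoch q (nu * / z)));
      [apply C_differentiable_at_Cinv, HD|].
    apply (C_differentiable_at_comp (qpoch q) (fun z => nu * / z));
      [apply C_differentiable_at_qpoch; assumption|].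
    apply (C_differentiable_at_mult (fun _ => nu) Cinv); [|exact Hi].
    apply C_differentiable_at_const.
Qed.

End SmallBase.

(** * The gauge factor for [|q| > 1] *)

Section LargeBase.

Context (q nu : C) (Hq1 : (1 < Cmod q)%R).

Definition gauge_gt1 (z : C) : C :=
  qpoch (/ q) (/ q * nu * / z) * / (qpoch (/ q) (- z) * qpoch (/ q) (- (/ q * / z))).

Lemma large_base_neq_0 : q <> 0.
Proof. apply Cmod_gt_0. lra. Qed.

Lemma Cinv_large_base_neq_0 : / q <> 0.
Proof.
  intros E. apply C1_nz. rewrite <- (Cinv_r _ large_base_neq_0), E. ring.
Qed.

Lemma Cmod_inv_large_base : (Cmod (/ q) < 1)%R.
Proof.
  rewrite Cmod_inv by exact large_base_neq_0.
  rewrite <- Rinv_1. apply Rinv_lt_contravar; lra.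
Qed.

Lemma qpoch_gauge_gt1_neq_0 (z : C) : gauge_domain q nu z ->
  qpoch (/ q) (/ q * nu * / z) <> 0 /\ qpoch (/ q) (- z) <> 0
  /\ qpoch (/ q) (- (/ q * / z)) <> 0.
Proof.
  intros (H0 & H1 & H2). pose proof large_base_neq_0 as Hq.
  repeat split; apply qpoch_neq_0;
    try apply Cinv_large_base_neq_0; try apply Cmod_inv_large_base;
    intros n E; rewrite Cpow_inv in E by exact Hq;
    pose proof (Cpow_nz q n Hq) as Hn.
  - apply (proj2 (not_q_spiral _ _ _ H1 (S n))). rewrite Cpow_S.
    transitivity (z * (q * q ^ n) * (/ q ^ n * (/ q * nu * / z)));
      [rewrite E; ring|field; repeat split; assumption].
  - apply (proj1 (not_q_spiral _ _ _ H2 n)).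
    transitivity (- (q ^ n * (/ q ^ n * - z))); [field; assumption|rewrite E; ring].
  - apply (proj2 (not_q_spiral _ _ _ H2 (S n))). rewrite Cpow_S.
    transitivity (z * (q * q ^ n) * (/ q ^ n * - (/ q * / z)));
      [rewrite E; ring|field; repeat split; assumption].
Qed.

(** In base [/ q] the recursions run in the opposite direction, so the two roles are swapped: the
    reciprocal theta function contributes [q z], and the numerator contributes [1 - nu / (q z)]. *)
Lemma gauge_factor_gt1 : gauge_factor q nu gauge_gt1.
Proof.
  pose proof large_base_neq_0 as Hq. pose proof Cinv_large_base_neq_0 as Hp0.
  pose proof Cmod_inv_large_base as Hp1.
  intros z Hz. pose proof (qpoch_gauge_gt1_neq_0 z Hz) as (HA & HB & HD).
  destruct Hz as (H0 & H1 & H2). split.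
  - apply Cmult_neq_0; [exact HA|]. intros E. apply C1_nz.
    rewrite <- (Cinv_r _ (Cmult_neq_0 _ _ HB HD)), E. ring.
  - unfold gauge_gt1.
    assert (Hqz : 1 + q * z <> 0).
    { intros E. apply (proj2 (not_q_spiral _ _ _ H2 1)).
      rewrite Cpow_1_r, Cmult_comm. apply Ceq_minus. rewrite <- E. ring. }
    rewrite (qpoch_rec _ Hp0 Hp1 (- (/ q * / z))) in HD |- *.
    rewrite (qpoch_rec _ Hp0 Hp1 (/ q * nu * / z)).
    rewrite (qpoch_rec _ Hp0 Hp1 (- (q * z))).
    replace (/ q * (/ q * nu * / z)) with (/ q * nu * / (q * z)) by (field; split; assumption).
    replace (/ q * - (q * z)) with (- z) by (field; assumption).
    replace (/ q * - (/ q * / z)) with (- (/ q * / (q * z))) in HD |- *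
      by (field; split; assumption).
    replace (1 - - (/ q * / z)) with ((1 + q * z) * / (q * z)) by (field; split; assumption).
    assert (qpoch (/ q) (- (/ q * / (q * z))) <> 0)
      by (intros E; apply HD; rewrite E; ring).
    replace (1 - - (q * z)) with (1 + q * z) by ring.
    field. repeat split; assumption.
Qed.

Lemma C_differentiable_at_gauge_gt1 (z : C) :
  gauge_domain q nu z -> C_differentiable_at gauge_gt1 z.
Proof.
  intros Hz. pose proof (qpoch_gauge_gt1_neq_0 z Hz) as (_ & HB & HD).
  pose proof (C_differentiable_at_Cinv z (proj1 Hz)) as Hi.
  assert (Hqp : forall x, C_differentiable_at (qpoch (/ q)) x)
    by (intros x; apply C_differentiable_at_qpoch;
        [apply Cinv_large_base_neq_0|apply Cmod_inv_large_base]).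
  apply (C_differentiable_at_mult
           (fun z => qpoch (/ q) (/ q * nu * / z))
           (fun z => / (qpoch (/ q) (- z) * qpoch (/ q) (- (/ q * / z))))).
  - apply (C_differentiable_at_comp (qpoch (/ q)) (fun z => / q * nu * / z)); [apply Hqp|].
    apply (C_differentiable_at_mult (fun _ => / q * nu) Cinv); [|exact Hi].
    apply C_differentiable_at_const.
  - apply (C_differentiable_at_comp Cinv
             (fun z => qpoch (/ q) (- z) * qpoch (/ q) (- (/ q * / z))));
      [apply C_differentiable_at_Cinv, Cmult_neq_0; assumption|].
    apply (C_differentiable_at_mult (fun z => qpoch (/ q) (- z))
             (fun z => qpoch (/ q) (- (/ q * / z)))).
    + apply (C_differentiable_at_comp (qpoch (/ q)) (fun z => - z)); [apply Hqp|].
      apply (C_differentiable_at_Copp (fun z => z)), C_differentiable_at_id.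
    + apply (C_differentiable_at_comp (qpoch (/ q)) (fun z => - (/ q * / z))); [apply Hqp|].
      apply C_differentiable_at_Copp, (C_differentiable_at_mult (fun _ => / q) Cinv);
        [|exact Hi].
      apply C_differentiable_at_const.
Qed.

End LargeBase.

(** * The gauge factor on free orbits, by choice of representatives *)

Section FreeOrbits.

Context (q nu : C) (Hq0 : q <> 0) (Hfree : forall n : nat, (0 < n)%nat -> q ^ n <> 1).

(** The factor in [phi(z) = orbit_prod n z * phi(q^n z)], obtained by iterating the functional
    equation [n] times. *)
Fixpoint orbit_prod (n : nat) (z : C) : C :=
  match n with
  | 0%nat => 1
  | S m => (q * z - nu) * orbit_prod m (q * z)
  end.

Lemma orbit_prod_add (m n : nat) (z : C) :
  orbit_prod (m + n) z = orbit_prod m z * orbit_prod n (q ^ m * z).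
Proof.
  revert z. induction m as [|m IH]; intros z; simpl.
  - rewrite !Cmult_1_l. reflexivity.
  - rewrite IH. replace (q ^ m * (q * z)) with (q * q ^ m * z) by ring. ring.
Qed.

Lemma orbit_prod_neq_0 (n : nat) (z : C) :
  ~ q_spiral q nu z -> orbit_prod n z <> 0.
Proof.
  (* Only forward iterates matter, and this form passes directly from [z] to [q * z] in the
     induction. *)
  intros Hz. assert (H : forall k, q ^ S k * z <> nu).
  { intros k. rewrite Cmult_comm. apply not_q_spiral, Hz. }
  clear Hz. revert z H. induction n as [|n IH]; intros z H; simpl; [apply C1_nz|].
  apply Cmult_neq_0.
  - intros E. apply (H 0%nat). rewrite Cpow_1_r. apply Ceq_minus, E.
  - apply IH. intros k. replace (q ^ S k * (q * z)) with (q ^ S (S k) * z)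
      by (simpl; ring). apply H.
Qed.

(** Natural exponents on both sides stand for one integer exponent. *)
Definition same_orbit (z w : C) : Prop := exists a b : nat, z * q ^ a = w * q ^ b.

Lemma same_orbit_sym (z w : C) : same_orbit z w -> same_orbit w z.
Proof. intros (a & b & E). exists b, a. symmetry. exact E. Qed.

Lemma same_orbit_trans (x y z : C) :
  same_orbit x y -> same_orbit y z -> same_orbit x z.
Proof.
  intros (a & b & E) (c & d & F). exists (a + c)%nat, (d + b)%nat.
  rewrite !Cpow_add_r, !Cmult_assoc, E, <- F. ring.
Qed.

Lemma Cpow_mult_cancel (z w : C) (n : nat) : z * q ^ n = w * q ^ n -> z = w.
Proof.
  intros E. pose proof (Cpow_nz q n Hq0) as H.
  transitivity (z * q ^ n * / q ^ n); [field; exact H|].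
  rewrite E. field. exact H.
Qed.

(** From [u q^k = a q^m] the smaller power cancels, leaving one of the two alternatives of
    [q_spiral]. *)
Lemma q_spiral_same_orbit (a z w : C) :
  same_orbit z w -> q_spiral q a w -> q_spiral q a z.
Proof.
  assert (Hsplit : forall u k m, u * q ^ k = a * q ^ m -> q_spiral q a u).
  { intros u k m E. destruct (Nat.le_ge_cases k m) as [L|L].
    - exists (m - k)%nat. left. apply (Cpow_mult_cancel _ _ k).
      rewrite E, <- Cmult_assoc, <- Cpow_add_r. repeat f_equal. lia.
    - exists (k - m)%nat. right. apply (Cpow_mult_cancel _ _ m).
      rewrite <- E, <- Cmult_assoc, <- Cpow_add_r. repeat f_equal. lia. }
  intros (b & c & E) [n [F|F]].
  - apply (Hsplit z b (n + c)%nat). rewrite E, F, Cpow_add_r. ring.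
  - apply (Hsplit z (b + n)%nat c). rewrite Cpow_add_r, Cmult_assoc, E, <- F. ring.
Qed.

Definition orbit_rep (z : C) : C := epsilon (inhabits (RtoC 0)) (same_orbit z).

Lemma same_orbit_rep (z : C) : same_orbit z (orbit_rep z).
Proof.
  unfold orbit_rep. apply (epsilon_spec (inhabits (RtoC 0)) (same_orbit z)).
  exists z, 0%nat, 0%nat. reflexivity.
Qed.

(** Points of one orbit define the same predicate by extensionality, so [epsilon] chooses the same
    representative. *)
Lemma orbit_rep_eq (z w : C) : same_orbit z w -> orbit_rep z = orbit_rep w.
Proof.
  intros H. unfold orbit_rep. f_equal.
  apply functional_extensionality. intros u. apply propositional_extensionality.
  split; apply same_orbit_trans; [apply same_orbit_sym|]; exact H.
Qed.

(** The value forced by [phi(orbit_rep z) = 1]: iterate from [z] and from the representative up to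
    their common point and divide. *)
Definition gauge_orbit_value (z v : C) : Prop :=
  exists a b : nat, z * q ^ a = orbit_rep z * q ^ b
    /\ v = orbit_prod a z / orbit_prod b (orbit_rep z).

Definition gauge_orbit (z : C) : C := epsilon (inhabits (RtoC 0)) (gauge_orbit_value z).

(** Cross-multiplying gives [q^(a+d) = q^(b+c)], and no positive power of [q] is 1. *)
Lemma orbit_exponents_unique (z w : C) (a b c d : nat) : z <> 0 ->
  z * q ^ a = w * q ^ b -> z * q ^ c = w * q ^ d -> (a + d = b + c)%nat.
Proof.
  intros Hz E F.
  assert (G : q ^ (a + d) = q ^ (b + c)).
  { assert (Hw : w <> 0).
    { intros Hw. apply (Cmult_neq_0 _ _ Hz (Cpow_nz q a Hq0)). rewrite E, Hw. ring. }
    assert (G : z * w * q ^ (a + d) = z * w * q ^ (b + c)).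
    { rewrite !Cpow_add_r.
      transitivity (z * q ^ a * (w * q ^ d)); [ring|]. rewrite E, <- F. ring. }
    transitivity (/ (z * w) * (z * w * q ^ (a + d)));
      [field; split; assumption|rewrite G; field; split; assumption]. }
  assert (Hlt : forall m n, (m < n)%nat -> q ^ m <> q ^ n).
  { intros m n L K. apply (Hfree (n - m)%nat); [lia|].
    apply (Cpow_mult_cancel _ _ m). rewrite <- Cpow_add_r.
    replace (n - m + m)%nat with n by lia. rewrite <- K. ring. }
  destruct (Nat.lt_trichotomy (a + d) (b + c)) as [L|[L|L]];
    [exfalso; exact (Hlt _ _ L G)|exact L|exfalso; exact (Hlt _ _ L (eq_sym G))].
Qed.

Lemma orbit_rep_not_q_spiral (z : C) :
  ~ q_spiral q nu z -> ~ q_spiral q nu (orbit_rep z).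
Proof.
  intros H K. apply H, (q_spiral_same_orbit _ _ (orbit_rep z)); [|exact K].
  apply same_orbit_rep.
Qed.

(** Independence of the exponents: raising both by [k] multiplies numerator and denominator by the
    same nonzero product, and raising [(c, d)] by [a] and [(a, b)] by [c] yields the same pair. *)
Lemma gauge_orbit_eq (z : C) (a b : nat) : z <> 0 -> ~ q_spiral q nu z ->
  z * q ^ a = orbit_rep z * q ^ b ->
  gauge_orbit z = orbit_prod a z / orbit_prod b (orbit_rep z).
Proof.
  intros Hz Hnu E.
  assert (Hr : forall n, orbit_prod n (orbit_rep z) <> 0)
    by (intros n; apply orbit_prod_neq_0, orbit_rep_not_q_spiral, Hnu).
  assert (Hext : forall a b k, z * q ^ a = orbit_rep z * q ^ b ->
            orbit_prod (a + k) z / orbit_prod (b + k) (orbit_rep z)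
            = orbit_prod a z / orbit_prod b (orbit_rep z)).
  { intros a' b' k E'. pose proof (Hr (b' + k)%nat) as H. rewrite !orbit_prod_add in *.
    rewrite (Cmult_comm (q ^ a')), E', (Cmult_comm (orbit_rep z)).
    field. split; [apply Hr|]. intros K. apply H. rewrite K. ring. }
  assert (Hex : exists v, gauge_orbit_value z v)
    by (eexists; exists a, b; split; [exact E|reflexivity]).
  destruct (epsilon_spec (inhabits (RtoC 0)) _ Hex) as (c & d & F & V).
  fold (gauge_orbit z) in V. rewrite V.
  pose proof (orbit_exponents_unique z _ a b c d Hz E F) as Heq.
  rewrite <- (Hext c d a F), <- (Hext a b c E).
  replace (d + a)%nat with (b + c)%nat by lia. rewrite (Nat.add_comm a c). reflexivity.
Qed.

Lemma gauge_factor_orbit : gauge_factor q nu gauge_orbit.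
Proof.
  intros z (H0 & H1 & _). destruct (same_orbit_rep z) as (a & b & E).
  assert (Hr : orbit_prod (S b) (orbit_rep z) <> 0)
    by (apply orbit_prod_neq_0, orbit_rep_not_q_spiral, H1).
  (* Raising both exponents ensures a positive one at [z]; then [(a, S b)] serves [q * z], and the
     numerators differ by exactly [q * z - nu]. *)
  assert (E1 : z * q ^ S a = orbit_rep z * q ^ S b)
    by (rewrite !Cpow_S; transitivity (q * (z * q ^ a)); [ring|rewrite E; ring]).
  pose proof (gauge_orbit_eq z (S a) (S b) H0 H1 E1) as V. split.
  - rewrite V. apply Cmult_neq_0; [apply orbit_prod_neq_0, H1|].
    intros K. apply C1_nz. rewrite <- (Cinv_r _ Hr), K. ring.
  - assert (Ho : same_orbit (q * z) z) by (exists 0%nat, 1%nat; simpl; ring).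
    assert (Hrep : orbit_rep (q * z) = orbit_rep z) by (apply orbit_rep_eq, Ho).
    rewrite V, (gauge_orbit_eq (q * z) a (S b)), Hrep.
    + simpl orbit_prod. unfold Cdiv. ring.
    + apply Cmult_neq_0; assumption.
    + intros K. apply H1, (q_spiral_same_orbit _ _ (q * z)); [apply same_orbit_sym, Ho|exact K].
    + rewrite Hrep, <- E1, Cpow_S. ring.
Qed.

End FreeOrbits.

(** * Existence of the gauge factor and the two equivalences *)

(** Splits on the modulus of [q]. The orbit construction covers [|q| = 1], where the
    differentiability clause is vacuous. *)
Lemma exists_gauge_factor (q nu : C) : q <> 0 ->
  (forall n : nat, (0 < n)%nat -> q ^ n <> 1) ->
  exists phi : C -> C, gauge_factor q nu phi
    /\ (Cmod q <> 1%R ->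
        forall z : C, gauge_domain q nu z -> C_differentiable_at phi z).
Proof.
  intros Hq Hfree. destruct (Rtotal_order (Cmod q) 1) as [H|[H|H]].
  - exists (gauge_lt1 q nu). split; [apply gauge_factor_lt1; assumption|].
    intros _. apply C_differentiable_at_gauge_lt1; assumption.
  - exists (gauge_orbit q nu). split; [apply gauge_factor_orbit; assumption|].
    intros K. contradiction.
  - exists (gauge_gt1 q nu). split; [apply gauge_factor_gt1; assumption|].
    intros _. apply C_differentiable_at_gauge_gt1; assumption.
Qed.

(** By the functional equation at [z] and at [z / q], the gauged left-hand side is [phi z] times the
    specialized one, and [phi z] is nonzero. *)
Lemma gauge_factor_equation (q nu : C) (phi : C -> C)
    (kappa1 nu1 nu2 nu3 nu8 d : C) (y : C -> C) (z : C) :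
  q <> 0 -> gauge_factor q nu phi -> gauge_domain q nu z ->
  (eq_specialized q kappa1 nu1 nu2 nu3 nu nu8 d y z
   <-> eq_gauged q kappa1 nu1 nu2 nu3 nu nu8 d (fun w => phi w * y w) z).
Proof.
  intros Hq Hphi Hz. destruct (Hphi z Hz) as [Hnz E1].
  destruct (Hphi (z / q) (gauge_domain_div q nu z Hq Hz)) as [_ E2].
  replace (q * (z / q)) with z in E2 by (field; exact Hq).
  unfold eq_specialized, eq_gauged. cbv beta.
  set (L := kappa1 / nu8 * z * y (q * z) + (nu1 * z ^ 2 - d * z) * y z
            + q * nu1 * nu2 * nu3 * (z - nu) * y (z / q)).
  replace (kappa1 / nu8 * z * (q * z - nu) * (phi (q * z) * y (q * z))
           + (nu1 * z ^ 2 - d * z) * (phi z * y z)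
           + q * nu1 * nu2 * nu3 * (phi (z / q) * y (z / q)))
    with (phi z * L).
  - split; intros H; [rewrite H; ring|].
    destruct (classic (L = 0)) as [K|K]; [exact K|].
    exfalso. exact (Cmult_neq_0 _ _ Hnz K H).
  - rewrite E2. unfold L, Cdiv.
    transitivity (kappa1 * / nu8 * z * y (q * z) * phi z
      + (nu1 * z ^ 2 - d * z) * (phi z * y z)
      + q * nu1 * nu2 * nu3 * (z - nu) * y (z * / q) * phi z); [ring|].
    rewrite E1 at 1. ring.
Qed.

(** At [f = nu4] the quotient [(z/q - nu4) / (f - z/q)] is -1, so the two terms in [g * y z] cancel.
    The remaining denominator is cleared by [q * (z - nu4)]. *)
Lemma L1_specialized (q kappa1 nu1 nu2 nu3 nu4 nu8 g : C) (y : C -> C) (z : C) :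
  q <> 0 -> nu4 <> 0 -> nu8 <> 0 -> g <> 0 -> z <> nu4 -> z <> q * nu4 ->
  q * (z - nu4) * L1 q kappa1 nu1 nu2 nu3 nu4 nu8 nu4 g y z
  = kappa1 / nu8 * z * y (q * z)
    + (nu1 * z ^ 2 - d_coef kappa1 nu1 nu4 nu8 g * z) * y z
    + q * nu1 * nu2 * nu3 * (z - nu4) * y (z / q).
Proof.
  intros Hq H4 H8 Hg Hz Hqz. unfold L1, Tz, Tz_inv, d_coef.
  assert (K1 : nu4 * q - z <> 0)
    by (intros K; apply Hqz; rewrite Cmult_comm; symmetry; apply Ceq_minus, K).
  assert (K2 : nu4 - z <> 0) by (intros K; apply Hz; symmetry; apply Ceq_minus, K).
  field. repeat split; assumption.
Qed.

Theorem mainTheorem16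
  (q kappa1 kappa2 nu1 nu2 nu3 nu4 nu5 nu6 nu7 nu8 f g : C)
  (Hq : q <> 0) (Hnu4 : nu4 <> 0) (Hnu8 : nu8 <> 0) (Hg : g <> 0)
  (Hparam : kappa1 ^ 2 * kappa2 ^ 2
            = q * (nu1 * nu2 * nu3 * nu4 * nu5 * nu6 * nu7 * nu8))
  (Hf : f = nu4) :
  let d := d_coef kappa1 nu1 nu4 nu8 g in
  (forall (y : C -> C) (z : C), z <> nu4 -> z <> q * nu4 ->
     (L1 q kappa1 nu1 nu2 nu3 nu4 nu8 f g y z = 0
      <-> eq_specialized q kappa1 nu1 nu2 nu3 nu4 nu8 d y z))
  /\
  ((forall n : nat, (0 < n)%nat -> q ^ n <> 1) ->
   exists phi : C -> C,
     (forall z : C, gauge_domain q nu4 z -> phi z <> 0)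
     /\ (Cmod q <> 1%R ->
         forall z : C, gauge_domain q nu4 z -> C_differentiable_at phi z)
     /\ (forall (y : C -> C) (z : C), gauge_domain q nu4 z ->
           (eq_specialized q kappa1 nu1 nu2 nu3 nu4 nu8 d y z
            <-> eq_gauged q kappa1 nu1 nu2 nu3 nu4 nu8 d
                  (fun w : C => phi w * y w) z))).
Proof.
  intros d. split.
  - intros y z Hz Hqz. subst f. unfold eq_specialized, d.
    rewrite <- L1_specialized by assumption.
    split; intros H; [rewrite H; ring|].
    destruct (classic (L1 q kappa1 nu1 nu2 nu3 nu4 nu8 nu4 g y z = 0)) as [K|K];
      [exact K|exfalso].
    revert H. repeat apply Cmult_neq_0; try assumption.
    intros E. apply Hz, Ceq_minus, E.
  - intros Hfree. destruct (exists_gauge_factor q nu4 Hq Hfree) as (phi & Hphi & Hdiff).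
    exists phi. split; [|split].
    + intros z Hz. apply Hphi, Hz.
    + exact Hdiff.
    + intros y z Hz. apply gauge_factor_equation; assumption.
Qed.
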